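(* Let $\mathcal{M}=\{\mathcal{H},\Sigma,\rho_0,\{\mathcal{E}_\sigma\}_{\sigma\in\Sigma\cup\{\triangleright,\$\}},\mathcal{H}_{acc},\mathcal{H}_{rej}\}$ be an MM-1gQFA, and let $P_{acc}$ be the projector onto $\mathcal{H}_{acc}$. Then $\mathcal{M}$ can be simulated by an MO-LM $\mathcal{M}'=\{\mathcal{H},\Sigma,\rho_0,\{\Theta_\sigma\}_{\sigma\in\Sigma\cup\{\triangleright,\$\}},P_{acc}\}$ (whose super-operators are indexed by $\Sigma\cup\{\triangleright,\$\}$, and which reads words over this extended alphabet), in the sense that $f_{\mathcal{M}}(x)=f_{\mathcal{M}'}(\triangleright x\$)$ holds for each $x\in\Sigma^*$.
   Context: For a finite-dimensional complex Hilbert space $\mathcal{H}$, let $L(\mathcal{H})$ be the set of linear operators on $\mathcal{H}$. A density operator is a positive semidefinite operator of trace $1$; the support $\mathrm{supp}(A)$ of a positive operator $A$ is the span of its eigenvectors with nonzero eigenvalue. A trace-preserving quantum operation acting on $\mathcal{H}$ is a map $\mathcal{E}:L(\mathcal{H})\to L(\mathcal{H})$ of the form $\mathcal{E}(\rho)=\sum_k E_k\rho E_k^\dagger$ (finite sum) with $\sum_k E_k^\dagger E_k=I$. A measure-many one-way general quantum finite automaton (MM-1gQFA) is a tuple $\mathcal{M}=\{\mathcal{H},\Sigma,\rho_0,\{\mathcal{E}_\sigma\}_{\sigma\in\Sigma\cup\{\triangleright,\$\}},\mathcal{H}_{acc},\mathcal{H}_{rej}\}$ where $\mathcal{H}$ is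 a finite-dimensional Hilbert space, $\Sigma$ is a finite input alphabet, $\triangleright,\$\notin\Sigma$ are the left and right end-markers, each $\mathcal{E}_\sigma$ is a trace-preserving quantum operation acting on $\mathcal{H}$, $\mathcal{H}_{acc},\mathcal{H}_{rej}$ are subspaces of $\mathcal{H}$ which together with another subspace $\mathcal{H}_{non}$ give an orthogonal decomposition $\mathcal{H}=\mathcal{H}_{acc}\oplus\mathcal{H}_{rej}\oplus\mathcal{H}_{non}$, and $\rho_0$ (the initial state) is a density operator on $\mathcal{H}$ with $\mathrm{supp}(\rho_0)\subseteq\mathcal{H}_{non}$. $P_{non},P_{acc},P_{rej}$ denote the orthogonal projectors onto $\mathcal{H}_{non},\mathcal{H}_{acc},\mathcal{H}_{rej}$. On input $x\in\Sigma^*$ the machine reads $\triangleright x\$$. Its total state is a triple $(\rho,p_{acc},p_{rej})\in L(\mathcal{H})\times\mathbb{R}\times\mathbb{R}$, starting at $(\rho_0,0,0)$, and reading a symbol $\sigma$ transforms it by $$(\rho,p_{acc},p_{rej})\mapsto\big(P_{non}\mathcal{E}_\sigma(\rho)P_{non},\ \mathrm{Tr}(P_{acc}\mathcal{E}_\sigma(\rho))+p_{acc},\ \mathrm{Tr}(P_{rej}\mathcal{E}_\sigma(\rho))+p_{rej}\big).$$ The accepting probability $f_{\mathcal{M}}(x)$ is the component $p_{acc}$ after all of $\triangleright x\$$ has been read. A Measure-Once Linear Machine (MO-LM) over a finite alphabet $\Gamma$ consists of a finite-dimensional Hilbert space $\mathcal{H}$, a density operator $\rho_0$ on $\mathcal{H}$,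 linear maps $\Theta_\sigma:L(\mathcal{H})\to L(\mathcal{H})$ for $\sigma\in\Gamma$ (not necessarily trace-preserving quantum operations), and an orthogonal projector $P_{acc}$ on a subspace of $\mathcal{H}$. It induces $f:\Gamma^*\to\mathbb{C}$, $f(x_1x_2\cdots x_m)=\mathrm{Tr}\big(\Theta_{x_m}\circ\cdots\circ\Theta_{x_2}\circ\Theta_{x_1}(\rho_0)\,P_{acc}\big)$. *)

(* Defs.v *)
(* The real numbers are an arbitrary [R : realType], the complex
   numbers are [R[i]], a finite-dimensional Hilbert space is a finite-dimensional
   vector space [H : vectType R[i]] with an inner product
   [dot : {dot H for Num.conj}] (conjugate-linear in its second argument), and
   L(H) is ['End(H)]. *)
From HB Require Import structures.
From mathcomp Require Import all_boot all_order all_algebra.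
From mathcomp Require Import complex reals.

Set Implicit Arguments.
Unset Strict Implicit.
Unset Printing Implicit Defensive.
Import Order.TTheory GRing.Theory Num.Theory.
Local Open Scope ring_scope.
Local Open Scope complex_scope.

Inductive marked (S : Type) : Type := LeftEnd | RightEnd | Letter of S.
Arguments LeftEnd {S}.
Arguments RightEnd {S}.

Definition marked_to_option (S : Type) (s : marked S) : option (option S) :=
  match s with
  | LeftEnd => None
  | RightEnd => Some None
  | Letter a => Some (Some a)
  end.

Definition option_to_marked (S : Type) (s : option (option S)) : marked S :=
  match s with
  | None => LeftEnd
  | Some None => RightEnd
  | Some (Some a) => Letter a
  end.

Lemma marked_to_optionK (S : Type) :
  cancel (@marked_to_option S) (@option_to_marked S).
Proof. by case. Qed.

HB.instance Definition _ (S : finType) :=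
  Finite.copy (marked S) (can_type (@marked_to_optionK S)).

Definition endmarked (S : Type) (x : seq S) : seq (marked S) :=
  LeftEnd :: rcons [seq Letter a | a <- x] RightEnd.

Section Operators.
Variables (R : realType) (H : vectType R[i]).

(* The sum of the diagonal entries of A in the basis [vbasis fullv]; the choice
   of the basis is immaterial. *)
Definition optrace (A : 'End(H)) : R[i] :=
  \sum_(i < \dim {: H}) coord (vbasis {: H}) i (A (vbasis {: H})`_i).

(* Membership in supp(A), the span of the eigenvectors of A with nonzero
   eigenvalue (allowing u = 0 does not change the span). *)
Definition in_supp (A : 'End(H)) (v : H) : Prop :=
  exists2 us : seq H,
    forall u, u \in us -> exists2 a : R[i], a != 0 & A u = a *: u
  & v \in <<us>>%VS.

End Operators.

Section Hilbert.
Variables (R : realType) (H : vectType R[i]) (dot : {dot H for Num.conj}).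

(* In the order of R[i], [0 <= z] says that z is real and nonnegative. *)
Definition possemidef (A : 'End(H)) : Prop := forall v : H, 0 <= dot (A v) v.

Definition density_operator (rho : 'End(H)) : Prop :=
  possemidef rho /\ optrace rho = 1.

Definition is_adjoint (A Adag : 'End(H)) : Prop :=
  forall u v : H, dot (A u) v = dot u (Adag v).

Definition tp_quantum_operation (E : 'End(H) -> 'End(H)) : Prop :=
  exists (m : nat) (K Kdag : 'I_m -> 'End(H)),
    [/\ forall k, is_adjoint (K k) (Kdag k),
        \sum_(k < m) (Kdag k \o K k)%VF = \1%VF
      & forall rho, E rho = \sum_(k < m) (K k \o rho \o Kdag k)%VF].

Definition orthoproj (V : {vspace H}) : 'End(H) := daddv_pi V (orthov dot V).

Record orthogonal_decomposition (U V W : {vspace H}) : Prop := {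
  decomp_UV : (U <= orthov dot V)%VS;
  decomp_UW : (U <= orthov dot W)%VS;
  decomp_VW : (V <= orthov dot W)%VS;
  decomp_full : (U + V + W)%VS = fullv
}.

Record MM_1gQFA (S : finType) := {
  mm_rho0 : 'End(H);
  mm_op : marked S -> 'End(H) -> 'End(H);
  mm_acc : {vspace H};
  mm_rej : {vspace H};
  mm_non : {vspace H};
  mm_opP : forall s, tp_quantum_operation (mm_op s);
  mm_decomp : orthogonal_decomposition mm_acc mm_rej mm_non;
  mm_rho0_density : density_operator mm_rho0;
  mm_rho0_supp : forall v, in_supp mm_rho0 v -> v \in mm_non
}.

Record MO_LM (Gamma : finType) := {
  mo_rho0 : 'End(H);
  mo_op : Gamma -> {linear 'End(H) -> 'End(H)};
  mo_Pacc : 'End(H);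
  mo_rho0_density : density_operator mo_rho0;
  mo_PaccP : exists V : {vspace H}, mo_Pacc = orthoproj V
}.

Section MMSemantics.
Variables (S : finType) (M : MM_1gQFA S).

(* The total state (rho, p_acc, p_rej). The traces below are real along every
   run, so [Re] only changes their type from R[i] to R. *)
Definition mm_step (st : 'End(H) * R * R) (s : marked S) : 'End(H) * R * R :=
  let: (rho, pacc, prej) := st in
  let rho' := mm_op M s rho in
  let Pnon := orthoproj (mm_non M) in
  let Pacc := orthoproj (mm_acc M) in
  let Prej := orthoproj (mm_rej M) in
  ((Pnon \o rho' \o Pnon)%VF,
   complex.Re (optrace (Pacc \o rho')%VF) + pacc,
   complex.Re (optrace (Prej \o rho')%VF) + prej).

Definition mm_accept (x : seq S) : R :=
  let: (_, pacc, _) := foldl mm_step (mm_rho0 M, 0, 0) (endmarked x) in pacc.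

End MMSemantics.

Definition mo_accept (Gamma : finType) (M : MO_LM Gamma) (w : seq Gamma) : R[i] :=
  optrace (foldl (fun rho s => mo_op M s rho) (mo_rho0 M) w \o mo_Pacc M)%VF.

End Hilbert.

(* Main.v *)
(** The linear machine carries the acceptance probability
    in its [P_acc]-block: take
    [Theta_s rho = E_s (P_non rho P_non) + P_acc rho P_acc].  Then the
    [P_non]-block of the state is the unnormalised state of the measure-many
    automaton, and [Tr (P_acc rho)] is the probability accumulated so far.
    At the start this needs [rho_0 = P_non rho_0 P_non] (spectral theorem for
    [rho_0]), and along the run it needs the traces to be real, which follows
    from self-adjointness of the state. *)
Require Import Defs.
From HB Require Import structures.
From mathcomp Require Import all_boot all_order all_algebra.
From mathcomp Require Import ring complex reals.

Set Implicit Arguments.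
Unset Strict Implicit.
Unset Printing Implicit Defensive.
Import Order.TTheory GRing.Theory Num.Theory passmx.
Local Open Scope ring_scope.
Local Open Scope complex_scope.

(** * The trace as a matrix trace *)

Section Trace.
Variables (R : realType) (H : vectType R[i]).

Lemma optrace_mxof (A : 'End(H)) :
  optrace A = \tr (mxof (vbasis {: H}) (vbasis {: H}) A).
Proof.
apply: eq_bigr => i _.
by rewrite mxE /= vecof_delta mxE.
Qed.

Lemma optraceD (A B : 'End(H)) :
  optrace (A + B) = optrace A + optrace B.
Proof. by rewrite !optrace_mxof linearD /= linearD. Qed.

Lemma optrace0 : optrace (0 : 'End(H)) = 0.
Proof. by rewrite optrace_mxof linear0 linear0. Qed.

Lemma optraceC (A B : 'End(H)) : optrace (A \o B)%VF = optrace (B \o A)%VF.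
Proof.
have bH := vbasisP {: H}.
by rewrite !optrace_mxof !(mxof_comp _ _ bH) mxtrace_mulC.
Qed.

End Trace.

(** * Self-adjoint operators and the reality of their traces *)

Section Hilbert.
Variables (R : realType) (H : vectType R[i]) (dot : {dot H for Num.conj}).
Implicit Types (A B P : 'End(H)) (U V : {vspace H}) (u v w : H).

Notation selfadjoint A := (is_adjoint dot A A).

Lemma dot_conj u v : dot u v = Num.conj (dot v u).
Proof. by rewrite hermC expr0 mul1r. Qed.

Lemma eq_dot u v : (forall w, dot u w = dot v w) -> u = v.
Proof.
move=> uv; apply/eqP; rewrite -subr_eq0 -(dnorm_eq0 dot) linearBl /= uv.
by rewrite subrr.
Qed.

(** Polarisation: since [dot (A w) w] is real at [u + v] and at [u + 'i *: v], [p + q] is real and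
    [p - q] is purely imaginary, so [p] is the conjugate of [q]. *)
Lemma possemidef_selfadjoint A : possemidef dot A -> selfadjoint A.
Proof.
move=> Apos u v.
have realA w : Num.conj (dot (A w) w) = dot (A w) w.
  by apply/eqP; rewrite -CrealE ger0_real.
set p := dot (A u) v; rewrite dot_conj; set q := dot (A v) u.
have e1 : Num.conj p + Num.conj q = p + q.
  have := realA (u + v).
  rewrite [A _]linearD /= linearDl /= !linearDr /= -/p -/q.
  rewrite !rmorphD /= !realA => /eqP; rewrite -subr_eq0 => /eqP E.
  by apply/eqP; rewrite -subr_eq0 -E; apply/eqP; ring.
have e2 : Num.conj p - Num.conj q = q - p.
  have := realA (u + 'i%R *: v).
  rewrite [A _]linearD linearZ /= linearDl linearZl_LR /= !linearDr /=.
  rewrite !linearZr_LR /= -/p -/q.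
  rewrite !(rmorphD, rmorphM) /= !realA !conjCi rmorphN /= conjCi opprK.
  move=> /eqP; rewrite -subr_eq0 => /eqP E.
  by apply: (mulfI (neq0Ci _)); apply/eqP; rewrite -subr_eq0 -E; apply/eqP; ring.
have e3 : 2 * p = 2 * Num.conj q.
  rewrite (_ : 2 * p = p + q - (q - p)); last by ring.
  by rewrite -e1 -e2; ring.
by apply: mulfI e3; rewrite pnatr_eq0.
Qed.

Lemma is_adjoint_sym A B : is_adjoint dot A B -> is_adjoint dot B A.
Proof. by move=> AB u v; rewrite dot_conj -AB -dot_conj. Qed.

Lemma selfadjoint_conj A K Kd :
  is_adjoint dot K Kd -> selfadjoint A -> selfadjoint (K \o A \o Kd)%VF.
Proof.
move=> KKd sA u v.
by rewrite !comp_lfunE KKd sA (is_adjoint_sym KKd).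
Qed.

Lemma selfadjoint_sum (I : Type) (r : seq I) (F : I -> 'End(H)) :
  (forall k, selfadjoint (F k)) -> selfadjoint (\sum_(k <- r) F k).
Proof.
move=> sF; apply: (big_ind (fun A => selfadjoint A)) => //.
- by move=> u v; rewrite !lfunE /= linear0l linear0r.
- move=> A B sA sB u v; rewrite !lfunE /= linearDl linearDr /=.
  by rewrite sA sB.
Qed.

Lemma selfadjointD A B :
  selfadjoint A -> selfadjoint B -> selfadjoint (A + B).
Proof.
by move=> sA sB u v; rewrite !lfunE /= linearDl linearDr /= sA sB.
Qed.

(** Take adjoints on both sides of [P \o A = A]. *)
Lemma selfadjoint_fixr A P : selfadjoint A -> selfadjoint P ->
  (P \o A)%VF = A -> (A \o P)%VF = A.
Proof.
move=> sA sP PA; apply/lfunP => u; apply: eq_dot => v.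
by rewrite comp_lfunE sA sP -comp_lfunE PA sA.
Qed.

(* If [G] is the Gram matrix of the basis and [M] the matrix of [A], then
   self-adjointness says [M G = G M^*], and [G] is invertible. *)
Lemma optrace_selfadjoint_real A : selfadjoint A -> optrace A \is Num.real.
Proof.
move=> sA; rewrite CrealE optrace_mxof.
set e := vbasis {: H}; set M := mxof e e A.
have eb : basis_of {: H} e by exact: vbasisP.
pose G := \matrix_(i, j) dot e`_i e`_j : 'M_(\dim {: H}).
pose N := (map_mx Num.conj M)^T.
have Ae (i : 'I__) : A e`_i = \sum_k M i k *: e`_k.
  rewrite [LHS](coord_basis eb) ?memvf //; apply: eq_bigr => k _.
  by rewrite mxE /= vecof_delta mxE.
have MG : M *m G = G *m N.
  apply/matrixP => i j; rewrite !mxE.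
  transitivity (dot (A e`_i) e`_j).
    rewrite Ae linear_sumlz; apply: eq_bigr => k _.
    by rewrite linearZl_LR !mxE.
  rewrite sA Ae linear_sumr; apply: eq_bigr => k _.
  by rewrite linearZr_LR !mxE mulrC.
(* A row [x] killed by [G] is the coordinate row of a vector orthogonal to every basis vector, hence
   to itself. *)
have Gu : G \in unitmx.
  rewrite -row_free_unit -kermx_eq0; apply/eqP/row_matrixP => i.
  rewrite row0; set x := row i _.
  have xG : x *m G = 0 by apply/sub_kermxP; exact: row_sub.
  have dot_x (k : 'I__) : dot (vecof e x) e`_k = (x *m G) 0 k.
    rewrite mxE linear_sumlz; apply: eq_bigr => l _.
    by rewrite linearZl_LR !mxE.
  apply/eqP; rewrite -(vecof_eq0 eb) -(dnorm_eq0 dot).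
  rewrite {2}/vecof linear_sumr big1 // => k _.
  by rewrite linearZr_LR /= dot_x xG [X in _ * X]mxE mulr0.
(* By [MG], [M] and [N] are similar through [G]. *)
have trNM : \tr N = \tr M.
  by rewrite -[M](mulmxK Gu) MG mxtrace_mulC mulmxA mulVmx // mul1mx.
rewrite -[X in _ == X]trNM mxtrace_tr /mxtrace rmorph_sum /=; apply/eqP.
by apply: eq_bigr => k _; rewrite !mxE.
Qed.

(** * Spectral argument: the range of a self-adjoint operator lies in its support *)

(** The restriction [f] of [A] to [U] has a nonempty square matrix, and [R[i]] is algebraically
    closed. *)
Lemma exists_eigenvector A U : U != 0%VS -> {in U, forall u, A u \in U} ->
  exists a u, [/\ u \in U, u != 0 & A u = a *: u].
Proof.
move=> U0 AU.
pose f : 'End(subvs_of U) := (linfun (vsproj U) \o A \o linfun vsval)%VF.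
have bU := vbasisP {: subvs_of U}.
have [|a] := eigenvalue_closed (mxof (vbasis {: subvs_of U})
  (vbasis {: subvs_of U}) f).
  by rewrite dimvf /= lt0n dimv_eq0.
move=> /eigenvalueP[x xf x0].
set u := vecof (vbasis {: subvs_of U}) x.
exists a, (vsval u); split; first exact: subvsP.
  by rewrite -[0]/(vsval (0 : subvs_of U)) (inj_eq val_inj) vecof_eq0.
have : f u = a *: u.
  by apply: (can_inj (rVofK bU)); rewrite -mul_mxof xf linearZ /= vecofK.
rewrite /f !comp_lfunE !lfunE /= => /(congr1 vsval).
by rewrite vsprojK ?AU ?subvsP.
Qed.

(** Induction on the dimension of [U]: split off an eigenvector [u]. Its image is zero or lies in
    [V], and self-adjointness keeps the complement of [u] in [U] stable. *)
Lemma selfadjoint_stable_image A U V : selfadjoint A ->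
  (forall a u, a != 0 -> A u = a *: u -> u \in V) ->
  {in U, forall u, A u \in U} -> {in U, forall u, A u \in V}.
Proof.
move=> sA eigV; have [n] := ubnP (\dim U); elim: n U => // n IHn U.
rewrite ltnS => dimU AU w wU.
have [U0|/exists_eigenvector /(_ AU)[a [u [uU u0 Au]]]] := eqVneq U 0%VS.
  by move: wU; rewrite U0 memv0 => /eqP->; rewrite linear0 mem0v.
have AuV : A u \in V.
  have [a0|a0] := eqVneq a 0; first by rewrite Au a0 scale0r mem0v.
  by rewrite Au memvZ // (eigV a).
pose U' := (U :&: orthov dot <[u]>)%VS.
have uu0 : dot u u != 0 by rewrite dnorm_eq0.
(* [c *: u] is the component of [w] along [u], so the remainder falls in [U']. *)
pose c := dot w u / dot u u.
have w'U' : w - c *: u \in U'.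
  rewrite memv_cap memvB ?memvZ //= mem_orthov1.
  by rewrite linearBl /= linearZl_LR /= divfK // subrr.
have -> : A w = A (w - c *: u) + c *: A u.
  by rewrite -linearZ -linearD /= subrK.
apply: memvD; last exact: memvZ.
apply: (IHn U') => //.
- apply: leq_trans dimU; rewrite ltn_neqAle dimvS ?capvSl // andbT.
  (* Equal dimensions would put [u] in [U'], making it orthogonal to itself. *)
  apply: contraNneq uu0 => dimE.
  have : u \in U' by have/eqP-> : U' == U by rewrite eqEdim capvSl dimE /=.
  by rewrite memv_cap mem_orthov1 => /andP[].
- move=> v; rewrite !memv_cap !mem_orthov1 => /andP[vU /eqP vu].
  by rewrite AU //= sA Au linearZr_LR /= vu mulr0.
Qed.

Lemma selfadjoint_supp A V : selfadjoint A ->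
  (forall v, in_supp A v -> v \in V) -> forall u, A u \in V.
Proof.
move=> sA suppV u.
apply: (selfadjoint_stable_image (U := fullv) sA) (memvf u) => [a v a0 Av|v _];
  last exact: memvf.
apply: suppV; exists [:: v]; last by rewrite memv_span ?mem_head.
by move=> w; rewrite inE => /eqP->; exists a.
Qed.

(** * Orthogonal projectors *)

Lemma capv_orthov V : (V :&: orthov dot V = 0)%VS.
Proof.
apply/eqP; rewrite -subv0; apply/subvP => v.
rewrite memv_cap memv0 => /andP[vV /mem_orthovP/(_ v vV)/eqP].
by rewrite dnorm_eq0.
Qed.

Lemma addv_orthov V : (V + orthov dot V = fullv)%VS.
Proof.
apply/eqP; rewrite eqEsubv subvf /=; apply/subvP => v _.
have [x xV [y [-> _]]] := orthogonal_split dot (vbasis V) v.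
rewrite orthogonalE span_seq1 (span_basis (vbasisP V)) => yV.
apply: memv_add; last by rewrite memvE.
by rewrite -(span_basis (vbasisP V)).
Qed.

Lemma memv_orthoproj V u : orthoproj dot V u \in V.
Proof. exact: memv_pi. Qed.

Lemma orthoproj_id V u : u \in V -> orthoproj dot V u = u.
Proof. exact/daddv_pi_id/capv_orthov. Qed.

Lemma sub_orthoproj V u : u - orthoproj dot V u \in orthov dot V.
Proof.
rewrite -{1}[u](daddv_pi_add (capv_orthov V)) ?addv_orthov ?memvf //.
by rewrite addrC addKr memv_pi.
Qed.

Lemma orthoproj_orthov V u : u \in orthov dot V -> orthoproj dot V u = 0.
Proof.
move=> uV; apply/eqP; rewrite -memv0 -(capv_orthov V) memv_cap.
rewrite memv_orthoproj /= -[orthoproj _ _ _](subKr u).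
by rewrite memvB ?sub_orthoproj.
Qed.

(** Both sides equal the product of the two projections, since [v] minus its projection is
    orthogonal to [V]. *)
Lemma orthoproj_selfadjoint V : selfadjoint (orthoproj dot V).
Proof.
have dotP u v : dot (orthoproj dot V u) v =
    dot (orthoproj dot V u) (orthoproj dot V v).
  apply/eqP; rewrite -subr_eq0 -linearBr /= herm_eq0C; apply/eqP.
  by have /mem_orthovP := sub_orthoproj V v; apply; exact: memv_orthoproj.
by move=> u v; rewrite dotP dot_conj -dotP -dot_conj.
Qed.

Lemma orthoproj_comp_id V A :
  (forall u, A u \in V) -> (orthoproj dot V \o A)%VF = A.
Proof. by move=> AV; apply/lfunP => u; rewrite comp_lfunE orthoproj_id. Qed.

Lemma orthoproj_idem V :
  (orthoproj dot V \o orthoproj dot V)%VF = orthoproj dot V.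
Proof. by apply: orthoproj_comp_id => u; exact: memv_orthoproj. Qed.

Lemma orthoproj_comp0 U V : (V <= orthov dot U)%VS ->
  (orthoproj dot U \o orthoproj dot V)%VF = 0.
Proof.
move=> /subvP VU; apply/lfunP => u.
by rewrite comp_lfunE lfunE /= orthoproj_orthov // VU ?memv_orthoproj.
Qed.

(** * Linearity and self-adjointness under quantum operations *)

(** Serves both the Kraus terms and the projector blocks of [sim_op]. *)
Lemma comp_lfun_sandwichP a A B C D :
  (A \o (a *: C + D) \o B = a *: (A \o C \o B) + (A \o D \o B))%VF.
Proof. by rewrite comp_lfunDr comp_lfunDl -comp_lfunZr -comp_lfunZl. Qed.

Lemma tp_quantum_operation_linear E :
  tp_quantum_operation dot E -> linear E.
Proof.
move=> [m [K [Kd [_ _ EE]]]] a A B; rewrite !EE scaler_sumr -big_split /=.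
by apply: eq_bigr => k _; exact: comp_lfun_sandwichP.
Qed.

Lemma tp_quantum_operation_selfadjoint E A :
  tp_quantum_operation dot E -> selfadjoint A -> selfadjoint (E A).
Proof.
move=> [m [K [Kd [KKd _ ->]]]] sA.
by apply: selfadjoint_sum => k; exact: selfadjoint_conj.
Qed.

(** * The simulating linear machine *)

Section Simulation.
Variables (S : finType) (M : MM_1gQFA dot S).

Let Pnon := orthoproj dot (mm_non M).
Let Pacc := orthoproj dot (mm_acc M).

(** The rejecting block is dropped, so the trace is not preserved in general. *)
Definition sim_op (s : marked S) (rho : 'End(H)) : 'End(H) :=
  (mm_op M s (Pnon \o rho \o Pnon) + (Pacc \o rho \o Pacc))%VF.

Lemma sim_op_linear s : linear (sim_op s).
Proof.
(* With concrete projectors, unification tries to identify them by unfolding. *)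
rewrite /sim_op; move: (Pnon) (Pacc) => P Q a A B.
rewrite (comp_lfun_sandwichP a P) (comp_lfun_sandwichP a Q).
rewrite (tp_quantum_operation_linear (mm_opP M s)).
by rewrite scalerDr addrACA.
Qed.

HB.instance Definition _ s :=
  GRing.isLinear.Build _ _ _ _ (sim_op s) (sim_op_linear s).

Lemma Pacc_Pnon : (Pacc \o Pnon)%VF = 0.
Proof.
apply: orthoproj_comp0; rewrite orthov_sym.
exact: decomp_UW (mm_decomp M).
Qed.

Lemma Pnon_Pacc : (Pnon \o Pacc)%VF = 0.
Proof. exact/orthoproj_comp0/(decomp_UW (mm_decomp M)). Qed.

Lemma sim_op_selfadjoint s rho : selfadjoint rho -> selfadjoint (sim_op s rho).
Proof.
move=> sr; apply: selfadjointD.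
  apply: tp_quantum_operation_selfadjoint; first exact: mm_opP.
  exact/selfadjoint_conj/sr/orthoproj_selfadjoint.
exact/selfadjoint_conj/sr/orthoproj_selfadjoint.
Qed.

(** The stored accepting block vanishes because [Pnon \o Pacc = 0]; what remains is the operator
    component of [mm_step]. *)
Lemma Pnon_sim_op s rho : (Pnon \o sim_op s rho \o Pnon)%VF =
  (Pnon \o mm_op M s (Pnon \o rho \o Pnon) \o Pnon)%VF.
Proof.
rewrite /sim_op comp_lfunDr comp_lfunDl !comp_lfunA Pnon_Pacc.
by rewrite !comp_lfun0l addr0.
Qed.

Lemma optrace_sim_op s rho : optrace (sim_op s rho \o Pacc)%VF =
  optrace (Pacc \o mm_op M s (Pnon \o rho \o Pnon))%VF
  + optrace (rho \o Pacc)%VF.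
Proof.
rewrite /sim_op comp_lfunDl optraceD optraceC; congr (_ + _).
by rewrite -!comp_lfunA orthoproj_idem optraceC -comp_lfunA orthoproj_idem.
Qed.

(** By idempotence and cyclicity the trace is that of [Pacc \o A \o Pacc], which is self-adjoint. *)
Lemma optrace_Pacc_real A : selfadjoint A ->
  optrace (Pacc \o A)%VF \is Num.real.
Proof.
move=> sA; rewrite -[Pacc]orthoproj_idem -comp_lfunA optraceC.
apply: optrace_selfadjoint_real.
exact/selfadjoint_conj/sA/orthoproj_selfadjoint.
Qed.

(** The run invariant, stated from an arbitrary self-adjoint [rho] so that induction on the word
    applies after each symbol. *)
Lemma mm_step_sim_op (w : seq (marked S)) rho pacc prej : selfadjoint rho ->
  pacc%:C = optrace (rho \o Pacc)%VF ->
  (foldl (mm_step M) ((Pnon \o rho \o Pnon)%VF, pacc, prej) w).1.2%:C =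
  optrace (foldl (fun rho s => sim_op s rho) rho w \o Pacc)%VF.
Proof.
elim: w rho pacc prej => [|s w IHw] //= rho pacc prej sr paccE.
rewrite -/Pnon -Pnon_sim_op; apply: IHw; first exact: sim_op_selfadjoint.
(* The newly accepted probability is a real trace, so [Re] in [mm_step] loses nothing. *)
rewrite optrace_sim_op rmorphD /= paccE RRe_real // optrace_Pacc_real //.
apply: tp_quantum_operation_selfadjoint; first exact: mm_opP.
exact/selfadjoint_conj/sr/orthoproj_selfadjoint.
Qed.

Lemma mm_rho0_selfadjoint : selfadjoint (mm_rho0 M).
Proof. exact/possemidef_selfadjoint/(proj1 (mm_rho0_density M)). Qed.

(** The range of [mm_rho0 M] lies in its support, hence in [mm_non M]; this gives the left-hand
    identity, and adjoints turn it into the right-hand one. *)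
Lemma mm_rho0_Pnon : (mm_rho0 M \o Pnon)%VF = mm_rho0 M.
Proof.
apply: selfadjoint_fixr (mm_rho0_selfadjoint) (orthoproj_selfadjoint _) _.
exact/orthoproj_comp_id/(selfadjoint_supp mm_rho0_selfadjoint)/mm_rho0_supp.
Qed.

Lemma Pnon_mm_rho0_Pnon : (Pnon \o mm_rho0 M \o Pnon)%VF = mm_rho0 M.
Proof.
rewrite -comp_lfunA [X in (_ \o X)%VF]mm_rho0_Pnon.
exact/orthoproj_comp_id/(selfadjoint_supp mm_rho0_selfadjoint)/mm_rho0_supp.
Qed.

(** Starts the invariant with accumulated probability zero. *)
Lemma mm_rho0_Pacc : (mm_rho0 M \o Pacc)%VF = 0.
Proof.
rewrite -[X in (X \o _)%VF]mm_rho0_Pnon -comp_lfunA.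
by rewrite [X in (_ \o X)%VF]Pnon_Pacc comp_lfun0r.
Qed.

Lemma mm_accept_sim_op x : (mm_accept M x)%:C =
  optrace (foldl (fun rho s => sim_op s rho) (mm_rho0 M) (endmarked x)
           \o Pacc)%VF.
Proof.
have pacc0 : (0 : R)%:C = optrace (mm_rho0 M \o Pacc)%VF.
  by rewrite mm_rho0_Pacc optrace0.
rewrite -(mm_step_sim_op (endmarked x) 0 mm_rho0_selfadjoint pacc0).
by rewrite Pnon_mm_rho0_Pnon /mm_accept; case: (foldl _ _ _) => [[]].
Qed.

End Simulation.
End Hilbert.

Theorem theorem11 (R : realType) (H : vectType R[i])
    (dot : {dot H for Num.conj}) (S : finType) (M : MM_1gQFA dot S) :
  exists M' : MO_LM dot (marked S),
    [/\ mo_rho0 M' = mm_rho0 M,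
        mo_Pacc M' = orthoproj dot (mm_acc M)
      & forall x : seq S, (mm_accept M x)%:C = mo_accept M' (endmarked x)].
Proof.
have PaccP : exists V, orthoproj dot (mm_acc M) = orthoproj dot V.
  by exists (mm_acc M).
exists (@Build_MO_LM _ _ dot (marked S) (mm_rho0 M) (fun s => sim_op M s)
  (orthoproj dot (mm_acc M)) (mm_rho0_density M) PaccP).
by split=> // x; exact: mm_accept_sim_op.
Qed.
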